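(* Let $K$ be a field and let $\phi:\mathfrak a\to\mathfrak b$ be a homomorphism of finite-dimensional abelian Lie algebras over $K$. Then $\operatorname{cd}(\phi)=\operatorname{rank}(\phi)=\dim_K(\operatorname{Im}\phi)$.
   Context: Modules over a Lie algebra $\mathfrak g$ over $K$ are left $\mathfrak g$-modules, equivalently left modules over the universal enveloping algebra $U(\mathfrak g)$ (no finiteness assumption; modules need not be trivial). $H^n(\mathfrak g,M)$ denotes Chevalley--Eilenberg cohomology (equivalently $\operatorname{Ext}^n_{U(\mathfrak g)}(K,M)$). For a Lie algebra homomorphism $\phi:\mathfrak g\to\mathfrak h$ and an $\mathfrak h$-module $M$, regarded as a $\mathfrak g$-module by restriction along $\phi$, there is an induced map $\phi^*:H^n(\mathfrak h,M)\to H^n(\mathfrak g,M)$ for each $n\ge 0$. The cohomological dimension of $\phi$ is $$\operatorname{cd}(\phi)=\sup\{n\ge 0:\ \text{there is an }\mathfrak h\text{-module }M\text{ with }\phi^*:H^n(\mathfrak h,M)\to H^n(\mathfrak g,M)\text{ nonzero}\}.$$ Here $\operatorname{rank}(\phi)$ is the rank of $\phi$ as a $K$-linear map. *)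

(* Defs.v *)
From HB Require Import structures.
From mathcomp Require Import all_boot all_order all_algebra.
From mathcomp Require Import all_classical constructive_ereal.

Set Implicit Arguments.
Unset Strict Implicit.
Unset Printing Implicit Defensive.

Import GRing.Theory.
Local Open Scope ring_scope.
Local Open Scope classical_set_scope.
Local Open Scope quotient_scope.

HB.mixin Record isLieAlgebra (K : fieldType) g of GRing.Lmodule K g := {
  lie : g -> g -> g;
  lie_linearl : forall y, linear (fun x => lie x y);
  lie_linearr : forall x, linear (lie x);
  liexx : forall x, lie x x = 0;
  lie_jacobi : forall x y z,
    lie x (lie y z) + lie y (lie z x) + lie z (lie x y) = 0
}.

#[short(type="lieAlgType")]
HB.structure Definition LieAlgebra (K : fieldType) :=
  {g of GRing.Lmodule K g & isLieAlgebra K g}.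

#[short(type="finLieAlgType")]
HB.structure Definition FinLieAlgebra (K : fieldType) :=
  {g of Vector K g & isLieAlgebra K g}.

Definition abelian_lie (K : fieldType) (g : lieAlgType K) : Prop :=
  forall x y : g, lie x y = 0.

Record lieHom (K : fieldType) (g h : lieAlgType K) := LieHom {
  lieHom_linear :> {linear g -> h};
  lieHom_lie : forall x y,
    lieHom_linear (lie x y) = lie (lieHom_linear x) (lieHom_linear y)
}.

Record lieModule (K : fieldType) (g : lieAlgType K) := LieModule {
  lieModule_sort :> lmodType K;
  act : g -> lieModule_sort -> lieModule_sort;
  act_linearl : forall v, linear (fun x => act x v);
  act_linearr : forall x, linear (act x);
  act_lie : forall x y v, act (lie x y) v = act x (act y v) - act y (act x v)
}.

Section Restriction.
Variables (K : fieldType) (g h : lieAlgType K) (phi : lieHom g h).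
Variable M : lieModule h.

Let res_act (x : g) (v : M) : M := act (phi x) v.

Let res_linearl v : linear (fun x => res_act x v).
Proof. by move=> c x y; rewrite /res_act linearP act_linearl. Qed.

Let res_linearr x : linear (res_act x).
Proof. by move=> c u v; rewrite /res_act act_linearr. Qed.

Let res_lie x y v :
  res_act (lie x y) v = res_act x (res_act y v) - res_act y (res_act x v).
Proof. by rewrite /res_act lieHom_lie act_lie. Qed.

Definition lie_res : lieModule g := LieModule res_linearl res_linearr res_lie.

End Restriction.

(** Chevalley-Eilenberg complex: Hom_K(Lambda^n g, M) is represented by the
    alternating K-multilinear maps g^n -> M. *)
Section ChevalleyEilenberg.
Variables (K : fieldType) (g : lieAlgType K) (M : lieModule g).
Implicit Types n : nat.

Definition ffun_upd n (x : {ffun 'I_n -> g}) (k : 'I_n) (v : g) :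
  {ffun 'I_n -> g} := [ffun l => if l == k then v else x l].

Definition is_cochain n (f : {ffun 'I_n -> g} -> M) : Prop :=
  (forall (x : {ffun 'I_n -> g}) k, linear (fun v => f (ffun_upd x k v))) /\
  (forall (x : {ffun 'I_n -> g}) (i j : 'I_n), i != j -> x i = x j -> f x = 0).

Definition omit n (i : 'I_n.+1) (x : {ffun 'I_n.+1 -> g}) :
  {ffun 'I_n -> g} := [ffun k => x (lift i k)].

(** The family ([x_i, x_j], x_0, .., x_n) with x_i and x_j left out; for
    i != j the list below has exactly n elements, so that the default value
    of [nth] is not reached. *)
Definition contract n (i j : 'I_n.+1) (x : {ffun 'I_n.+1 -> g}) :
  {ffun 'I_n -> g} :=
  [ffun k : 'I_n => nth 0
     (lie (x i) (x j) ::
      [seq x l | l <- enum 'I_n.+1 & (l != i) && (l != j)]) k].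

Definition ce_diff n (f : {ffun 'I_n -> g} -> M) :
  {ffun 'I_n.+1 -> g} -> M := fun x =>
    \sum_(i < n.+1) (-1) ^+ i *: act (x i) (f (omit i x)) +
    \sum_(i < n.+1) \sum_(j < n.+1 | (i < j)%N)
       (-1) ^+ (i + j) *: f (contract i j x).

Lemma is_cochainP n (c : K) (f f' : {ffun 'I_n -> g} -> M) :
  is_cochain f -> is_cochain f' -> is_cochain (c *: f + f').
Proof.
move=> [fl fa] [f'l f'a]; split=> [x k a u v|x i j ij xij].
  have E (w : {ffun 'I_n -> g}) : (c *: f + f') w = c *: f w + f' w by [].
  rewrite !E fl f'l !scalerDr !scalerA (mulrC c a) -!addrA; congr (_ + _).
  by rewrite addrCA.
change (c *: f x + f' x = 0).
by rewrite (fa _ _ _ ij xij) (f'a _ _ _ ij xij) scaler0 addr0.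
Qed.

Lemma is_cochain0 n : is_cochain (0 : {ffun 'I_n -> g} -> M).
Proof.
split=> // x k a u v.
by change (0 = a *: (0 : M) + 0); rewrite scaler0 addr0.
Qed.

Lemma ce_diffP n (c : K) (f f' : {ffun 'I_n -> g} -> M) :
  ce_diff (c *: f + f') = c *: ce_diff f + ce_diff f'.
Proof.
apply/funext => x.
have E m (u u' : {ffun 'I_m -> g} -> M) w :
  (c *: u + u') w = c *: u w + u' w by [].
rewrite E /ce_diff scalerDr addrACA; congr (_ + _).
  rewrite scaler_sumr -big_split /=; apply: eq_bigr => i _.
  by rewrite E act_linearr scalerDr !scalerA mulrC.
rewrite scaler_sumr -big_split /=; apply: eq_bigr => i _.
rewrite scaler_sumr -big_split /=; apply: eq_bigr => j _.
by rewrite E scalerDr !scalerA mulrC.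
Qed.

Lemma ce_diff0 n : ce_diff (0 : {ffun 'I_n -> g} -> M) = 0.
Proof.
have := ce_diffP (-1) (0 : {ffun 'I_n -> g} -> M) 0.
by rewrite scaler0 addr0 scaleN1r addNr.
Qed.

Definition cocycle n : {pred {ffun 'I_n -> g} -> M} :=
  fun f => `[< is_cochain f /\ ce_diff f = 0 >].

Lemma cocycle_zmod_closed n : zmod_closed (@cocycle n).
Proof.
split=> [|f f' /asboolP[fc fd] /asboolP[f'c f'd]]; apply/asboolP.
  by split; [exact: is_cochain0|exact: ce_diff0].
rewrite addrC -scaleN1r; split; first exact: is_cochainP.
by rewrite ce_diffP fd f'd scaler0 addr0.
Qed.

HB.instance Definition _ n :=
  GRing.isZmodClosed.Build _ (@cocycle n) (@cocycle_zmod_closed n).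

Record cocycles n := Cocycle {
  cocycle_val :> {ffun 'I_n -> g} -> M;
  cocycle_valP : cocycle_val \in @cocycle n
}.

HB.instance Definition _ n := [isSub for @cocycle_val n].
HB.instance Definition _ n := [Choice of cocycles n by <:].
HB.instance Definition _ n := [SubChoice_isSubZmodule of cocycles n by <:].

Definition is_coboundary n : ({ffun 'I_n -> g} -> M) -> Prop :=
  if n is m.+1 then fun f => exists2 u, @is_cochain m u & f = ce_diff u
  else fun f => f = 0.

Definition coboundary n : {pred cocycles n} := fun f => `[< is_coboundary f >].

Lemma coboundary_zmod_closed n : zmod_closed (@coboundary n).
Proof.
split=> [|f f' /asboolP fB /asboolP f'B]; apply/asboolP.
  by case: n => [//|n]; exists 0; [exact: is_cochain0|rewrite ce_diff0].
case: n f f' fB f'B => [|n] f f' /=; first by move=> -> ->; rewrite subrr.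
move=> [u uc fu] [u' u'c f'u']; exists (-1 *: u' + u); first exact: is_cochainP.
by rewrite ce_diffP -fu -f'u' scaleN1r addrC.
Qed.

HB.instance Definition _ n :=
  GRing.isZmodClosed.Build _ (@coboundary n) (@coboundary_zmod_closed n).

Definition lieH n : zmodType := Quotient.quot (@coboundary n).

End ChevalleyEilenberg.

Section Pullback.
Variables (K : fieldType) (g h : lieAlgType K) (phi : lieHom g h).
Variable M : lieModule h.
Implicit Types n : nat.

Definition ffun_hom n (x : {ffun 'I_n -> g}) : {ffun 'I_n -> h} :=
  [ffun k => phi (x k)].

Definition pull n (f : {ffun 'I_n -> h} -> M) :
  {ffun 'I_n -> g} -> lie_res phi M := fun x => f (ffun_hom x).

Lemma pull_cochain n (f : {ffun 'I_n -> h} -> M) :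
  is_cochain f -> is_cochain (pull f).
Proof.
have updE x k v :
    ffun_hom (ffun_upd x k v) = ffun_upd (@ffun_hom n x) k (phi v).
  by apply/ffunP => l; rewrite !ffunE; case: (l == k).
move=> [fl fa]; split=> [x k a u v|x i j ij xij].
  by rewrite /pull !updE linearP fl.
by apply: (fa _ _ _ ij); rewrite !ffunE xij.
Qed.

Lemma pull_diff n (f : {ffun 'I_n -> h} -> M) :
  pull (ce_diff f) = ce_diff (pull f).
Proof.
apply/funext => x; rewrite /pull /ce_diff; congr (_ + _).
  apply: eq_bigr => i _; congr (_ *: _); rewrite /= ffunE; congr (act _ (f _)).
  by apply/ffunP => k; rewrite !ffunE.
apply: eq_bigr => i _; apply: eq_bigr => j _; congr (_ *: f _).
apply/ffunP => k; rewrite !ffunE -lieHom_lie; case: (val k) => [//|m] /=.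
set s := [seq l <- _ | _]; have [ms|ms] := ltnP m (size s).
  by rewrite !(nth_map i) // ffunE.
by rewrite !nth_default ?size_map // linear0.
Qed.

Lemma pull_cocycle n (f : cocycles M n) :
  pull f \in @cocycle K g (lie_res phi M) n.
Proof.
have /asboolP[fc fd] := cocycle_valP f; apply/asboolP; split.
  exact: pull_cochain.
by rewrite -pull_diff fd.
Qed.

Definition pullZ n (f : cocycles M n) : cocycles (lie_res phi M) n :=
  Cocycle (pull_cocycle f).

Lemma pullZB n : zmod_morphism (@pullZ n).
Proof. by move=> f f'; apply: val_inj. Qed.

HB.instance Definition _ n := GRing.isZmodMorphism.Build _ _ _ (@pullZB n).

Lemma pull_coboundary n (f : cocycles M n) :
  f \in @coboundary K h M n ->
  pullZ f \in @coboundary K g (lie_res phi M) n.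
Proof.
case: n f => [|n] f /asboolP /=; first by move=> f0; apply/asboolP; rewrite /= f0.
move=> [u uc fu]; apply/asboolP; exists (pull u); first exact: pull_cochain.
by rewrite /= fu pull_diff.
Qed.

(** The induced map; it is computed on a representative, and [lieH_mapE] says
    that the choice of the representative is irrelevant. *)
Definition lieH_map n (c : lieH M n) : lieH (lie_res phi M) n :=
  \pi_(lieH (lie_res phi M) n) (pullZ (repr c)).

Lemma lieH_mapE n (f : cocycles M n) :
  lieH_map (\pi_(lieH M n) f) = \pi_(lieH (lie_res phi M) n) (pullZ f).
Proof.
apply/eqP; rewrite /lieH_map -Quotient.idealrBE -raddfB.
apply: pull_coboundary; rewrite Quotient.idealrBE.
by apply/eqP; rewrite reprK.
Qed.

Lemma lieH_mapB n : zmod_morphism (@lieH_map n).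
Proof.
move=> c c'; rewrite -[c]reprK -[c']reprK -raddfB.
by rewrite !lieH_mapE -raddfB; congr (\pi _); exact: pullZB.
Qed.

HB.instance Definition _ n := GRing.isZmodMorphism.Build _ _ _ (@lieH_mapB n).

End Pullback.

(** The supremum is taken in the order of the extended integers, where every
    set of natural numbers has one (it is +oo if the set is unbounded). *)
Definition cd (K : fieldType) (g h : lieAlgType K) (phi : lieHom g h) :
  \bar int :=
  supremum -oo%E [set (n%:Z)%:E | n in
    [set n : nat | exists (M : lieModule h) (c : lieH M n),
                     lieH_map phi c != 0]].

Definition lie_rank (K : fieldType) (a b : finLieAlgType K)
  (phi : lieHom a b) : nat := \dim (limg (linfun phi)).

(* Main.v *)
Require Import Defs.
From mathcomp Require Import all_boot all_order all_algebra.
From mathcomp Require Import all_classical constructive_ereal.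

(** An alternating [n]-form on [b] vanishes on linearly dependent families, so
    for [n] larger than the rank of [phi] the pullback along [phi] is already
    zero on cochains. In degree [n = rank phi], take trivial coefficients [K]:
    then all Chevalley-Eilenberg differentials vanish, and the determinant of
    the coordinates with respect to a basis of [Im phi] is a cocycle whose
    pullback takes the value 1 on a lift of that basis. *)

Section Cochains.
Import GRing.Theory.
Local Open Scope ring_scope.
Context {K : fieldType} {g : lieAlgType K} {M : lieModule g}.

Lemma cochain_sum {n} {f : {ffun 'I_n -> g} -> M} (x : {ffun 'I_n -> g})
    (k : 'I_n) {I : finType} (c : I -> K) (v : I -> g) : is_cochain f ->
  f (ffun_upd x k (\sum_i c i *: v i)) = \sum_i c i *: f (ffun_upd x k (v i)).
Proof.
case=> fl _.
have f0 : f (ffun_upd x k 0) = 0.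
  by have := fl x k (-1) 0 0; rewrite scaler0 addr0 scaleN1r addNr.
apply: (big_ind2 (fun w m => f (ffun_upd x k w) = m)) => //=
  [u1 s1 u2 s2 <- <-|i _].
  by have := fl x k 1 u1 u2; rewrite !scale1r.
by have := fl x k (c i) (v i) 0; rewrite f0 !addr0.
Qed.

(** Substituting the relation into slot [k] gives 0, while expanding it by linearity leaves only
    [c k *: f x]: every other term has a repeated entry. *)
Lemma cochain_dependent {n} {f : {ffun 'I_n -> g} -> M} {x : {ffun 'I_n -> g}}
    {c : 'I_n -> K} {k : 'I_n} :
  is_cochain f -> \sum_i c i *: x i = 0 -> c k != 0 -> f x = 0.
Proof.
move=> fC cx0 ck0; have [_ fa] := fC.
have updk : ffun_upd x k (x k) = x.
  by apply/ffunP => l; rewrite ffunE; case: eqP => [->|].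
have : c k *: f x = 0.
  (* the empty sum gives the value 0 at [ffun_upd x k 0] *)
  have := cochain_sum x k (fun _ : 'I_0 => 0) (fun=> 0) fC.
  rewrite !big_ord0 -cx0 (cochain_sum _ _ _ _ fC) (bigD1 k) //= updk.
  rewrite big1 ?addr0 // => i ik.
  have -> : f (ffun_upd x k (x i)) = 0; last by rewrite scaler0.
  by apply: (fa _ i k ik); rewrite !ffunE eqxx (negPf ik).
by move/eqP; rewrite scaler_eq0 (negPf ck0) => /eqP.
Qed.

Lemma cochain_entry0 {n} {f : {ffun 'I_n -> g} -> M} {x : {ffun 'I_n -> g}}
    (k : 'I_n) : is_cochain f -> x k = 0 -> f x = 0.
Proof.
move=> fC xk0.
apply: (cochain_dependent (c := fun i => (i == k)%:R) (k := k) fC).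
  rewrite (bigD1 k) //= xk0 scaler0 big1 ?addr0 // => i /negPf->.
  by rewrite scale0r.
by rewrite eqxx oner_neq0.
Qed.

(** The action terms vanish because [M] is trivial, the bracket terms because the zero bracket is an
    entry of the contracted family. *)
Lemma ce_diff_trivial {n} {f : {ffun 'I_n -> g} -> M} : abelian_lie g ->
  (forall (x : g) (v : M), act x v = 0) -> is_cochain f -> ce_diff f = 0.
Proof.
move=> gab Mtriv fC; apply/funext => x; rewrite /ce_diff.
rewrite big1 ?add0r => [|i _]; last by rewrite Mtriv scaler0.
rewrite big1 // => i _; rewrite big1 // => j ij.
(* Slot 0, which holds the bracket, exists only for positive [n]; for [n = 0] there is no pair
   [i < j]. *)
case: n => [|n] in f fC x i j ij *; first by rewrite !ord1 in ij.
by rewrite (cochain_entry0 ord0 fC) ?scaler0 // ffunE /= gab.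
Qed.

(** This reduces nonvanishing in cohomology to nonvanishing of a representing cocycle. *)
Lemma coboundary_trivial {n} {f : {ffun 'I_n -> g} -> M} : abelian_lie g ->
  (forall (x : g) (v : M), act x v = 0) -> is_coboundary f -> f = 0.
Proof.
move=> gab Mtriv; case: n f => [//|n] f [u uC ->].
exact: ce_diff_trivial.
Qed.

Lemma lieH_pi_eq0 {n} (f : cocycles M n) :
  (\pi_(lieH M n) f == 0)%qT = `[< is_coboundary f >].
Proof.
rewrite -[0](raddf0 (\pi_(lieH M n))%qT) -Quotient.idealrBE subr0.
by rewrite /in_mem.
Qed.

End Cochains.

Section TrivialModule.
Import GRing.Theory.
Local Open Scope ring_scope.
Variables (K : fieldType) (g : lieAlgType K).

Definition trivial_act (_ : g) (v : K^o) : K^o := 0.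

Let trivial_linearl v : linear (fun x => trivial_act x v).
Proof. by move=> c x y; rewrite /trivial_act scaler0 addr0. Qed.

Let trivial_linearr x : linear (trivial_act x).
Proof. by move=> c u v; rewrite /trivial_act scaler0 addr0. Qed.

Let trivial_lie x y v : trivial_act (lie x y) v =
  trivial_act x (trivial_act y v) - trivial_act y (trivial_act x v).
Proof. by rewrite /trivial_act subrr. Qed.

Definition trivial_module : lieModule g :=
  LieModule trivial_linearl trivial_linearr trivial_lie.

End TrivialModule.

Section DeterminantCochain.
Import GRing.Theory.
Local Open Scope ring_scope.
Context {K : fieldType} {b : finLieAlgType K} {n : nat} (e : n.-tuple b).

(** The wedge product of the coordinate functionals [coord e j], which are defined on all of [b] and
    not only on the span of [e]. *)
Definition det_form (y : {ffun 'I_n -> b}) : trivial_module K b :=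
  \det (\matrix_(i, j) coord e j (y i)).

Lemma det_form_cochain : is_cochain det_form.
Proof.
split=> [x k c u v|x i j ij xij]; last first.
  by apply: (determinant_alternate ij) => l; rewrite !mxE xij.
rewrite /det_form -[X in _ = _ + X]mul1r.
apply: (determinant_multilinear (i0 := k)).
- by apply/rowP => l; rewrite !mxE !ffunE eqxx linearP mul1r.
- by apply/matrixP => i j; rewrite !mxE !ffunE eq_sym (negPf (neq_lift _ _)).
- by apply/matrixP => i j; rewrite !mxE !ffunE eq_sym (negPf (neq_lift _ _)).
Qed.

Lemma det_form_basis : free e -> det_form [ffun i : 'I_n => e`_i] = 1.
Proof.
move=> efree; rewrite /det_form -[RHS](det1 _ n); congr (\det _).
by apply/matrixP => i j; rewrite !mxE ffunE coord_free.
Qed.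

End DeterminantCochain.

Section Rank.
Import GRing.Theory.
Local Open Scope ring_scope.
Context {K : fieldType} {a b : finLieAlgType K} (phi : lieHom a b).

(** The [n] vectors [phi (x i)] lie in the image, whose dimension is less than [n], so they satisfy
    a nontrivial linear relation. *)
Lemma pull_above_rank {M : lieModule b} {n} {f : {ffun 'I_n -> b} -> M} :
  (lie_rank phi < n)%N -> is_cochain f -> pull phi f = 0.
Proof.
move=> rn fC; apply/funext => x; rewrite /pull.
pose X := [tuple phi (x i) | i < n].
have Xi (i : 'I_n) : X`_i = phi (x i) by rewrite -tnth_nth tnth_mktuple.
have : ~~ free X.
  apply/negP => /eqP Xdim; move: rn; rewrite ltnNge => /negP; apply.
  rewrite -[n in (n <= _)%N](size_tuple X) -Xdim dimvS //.
  apply/span_subvP => y /mapP[i _ ->].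
  by rewrite -[phi _](lfunE phi) memv_img ?memvf.
(* If [f] were nonzero on the image family, every linear relation would have zero coefficients, and
   [X] would be free. *)
move=> /negP Xnf; apply: contrapT => fx0; apply: Xnf; apply/freeP => c cX i.
apply/eqP/negP => /negP ci0; apply: fx0.
apply: (cochain_dependent fC _ ci0); rewrite -[RHS]cX.
by apply: eq_bigr => j _; rewrite Xi ffunE.
Qed.

Lemma lieH_map_above_rank {M : lieModule b} {n} (c : lieH M n) :
  (lie_rank phi < n)%N -> lieH_map phi c = 0.
Proof.
move=> rn; have /asboolP[fC _] := cocycle_valP (repr c)%qT.
apply/eqP; rewrite /lieH_map -[0](raddf0 (\pi_(lieH (lie_res phi M) n))%qT).
by apply/eqP; congr (\pi _)%qT; apply: val_inj; exact: pull_above_rank.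
Qed.

Hypotheses (ha : abelian_lie a) (hb : abelian_lie b).

(** By [hb] the determinant form is a cocycle. By [ha], and since the restricted module is again
    trivial, the only coboundary on [a] is 0, so one nonzero value of the pullback suffices. *)
Lemma lieH_map_rank_neq0 :
  exists c : lieH (trivial_module K b) (lie_rank phi), lieH_map phi c != 0.
Proof.
set r := lie_rank phi; pose e : r.-tuple b := vbasis (limg (linfun phi)).
have fC := det_form_cochain e.
have fZ : det_form e \in @cocycle K b (trivial_module K b) r.
  by apply/asboolP; split; last exact: ce_diff_trivial.
exists (\pi_(lieH _ _) (Cocycle fZ))%qT.
rewrite lieH_mapE lieH_pi_eq0; apply/negP => /asboolP /= fB.
have f0 : pull (M := trivial_module K b) phi (det_form e) = 0.
  exact: coboundary_trivial fB.
pose x : {ffun 'I_r -> a} := [ffun i : 'I_r => ((linfun phi)^-1)%VF e`_i].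
have phix : ffun_hom phi x = [ffun i : 'I_r => e`_i].
  apply/ffunP => i; rewrite !ffunE -[LHS](lfunE phi) limg_lfunVK //.
  by rewrite vbasis_mem ?mem_nth ?size_tuple.
have := congr1 (fun F => F x) f0; rewrite /pull phix det_form_basis.
  by move/eqP; rewrite (negPf (oner_neq0 K)).
exact: basis_free (vbasisP _).
Qed.

End Rank.

Theorem theorem5p2 (K : fieldType) (a b : finLieAlgType K)
    (ha : abelian_lie a) (hb : abelian_lie b) (phi : lieHom a b) :
  cd phi = (lie_rank phi)%:Z%R%:E%E /\
  lie_rank phi = (\dim (limg (linfun phi)))%VS.
Proof.
split=> //; rewrite /cd; set A := (X in supremum _ X).
have Ar : A (lie_rank phi)%:Z%R%:E%E.
  by exists (lie_rank phi) => //=; exists (trivial_module K b);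
    exact: lieH_map_rank_neq0.
have rA : ubound A (lie_rank phi)%:Z%R%:E%E.
  move=> _ [n [M [c cn0]] <-]; rewrite lee_fin lez_nat leqNgt.
  by apply: contra cn0 => rn; rewrite lieH_map_above_rank.
(* As [A] is nonempty, the default value [-oo] is not taken. *)
rewrite /supremum ifF; last first.
  by apply/negbTE/set0P; exists (lie_rank phi)%:Z%R%:E%E.
(* The chosen value is some supremum of [A]; the rank, being the greatest element of [A], is one
   too, and suprema are unique. *)
case: xgetP => [y _ ys|/(_ (lie_rank phi)%:Z%R%:E%E)]; last first.
  by case; split=> // z; apply.
by apply: (is_subset1_supremums ys); split=> // z; apply.
Qed.
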